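(* Let $N\ge 1$ be an integer, let $\hbar,\gamma_2,\Omega_{\rm p},\Omega_{\rm c}>0$ and $\Omega_1,\dots,\Omega_N\ge 0$ be real constants. Consider the Lindblad master equation $$\frac{\partial \boldsymbol{\rho}}{\partial t}=\frac{j}{\hbar}(\boldsymbol{\rho}\mathbf{H}-\mathbf{H}\boldsymbol{\rho})+\mathcal{L}(\boldsymbol{\rho})$$ for $(N+3)\times(N+3)$ density matrices $\boldsymbol{\rho}=(\rho_{ik})$, with $\mathbf{H}$ and $\mathcal{L}$ as given in the context. The steady-state solution of the coherence term $\rho_{12}$ (the $(1,2)$ entry of $\boldsymbol{\rho}$) to this equation, i.e. its value when the steady-state condition $\frac{\partial\boldsymbol{\rho}}{\partial t}=0$ holds, is given by $$\rho_{12}=j\,\frac{\rho_0\sum_{n=1}^N\Omega_n^2}{\sum_{n=1}^N\Omega_n^2+\Gamma^2},$$ where $$\rho_0=\frac{\gamma_2\Omega_{\rm p}}{\gamma_2^2+2\Omega_{\rm p}^2},\qquad \Gamma=\sqrt{\frac{2\Omega_{\rm p}^2(\Omega_{\rm c}^2+\Omega_{\rm p}^2)}{\gamma_2^2+2\Omega_{\rm p}^2}}.$$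
   Context: Here $j$ is the imaginary unit. A density matrix is a Hermitian positive semidefinite complex $(N+3)\times(N+3)$ matrix $\boldsymbol{\rho}=(\rho_{ik})$ of trace $1$; it describes the quantum state of an $(N+3)$-level Rydberg atom. The constants $\Omega_{\rm p}$, $\Omega_{\rm c}$ and $\Omega_n$ are the Rabi frequencies of the probe laser, the coupling laser and the $n$-th radio-frequency band, and $\hbar$ is the reduced Planck constant. The Hamiltonian $\mathbf{H}$ (all transitions resonant) is the real symmetric $(N+3)\times(N+3)$ matrix whose only nonzero entries are $$H_{12}=H_{21}=\tfrac{\hbar}{2}\Omega_{\rm p},\quad H_{23}=H_{32}=\tfrac{\hbar}{2}\Omega_{\rm c},\quad H_{3,n+3}=H_{n+3,3}=\tfrac{\hbar}{2}\Omega_n\ (n=1,\dots,N).$$ The relaxation term $\mathcal{L}(\boldsymbol{\rho})$ (in which only the decay rate $\gamma_2$ of the second level is retained, all other decay rates being neglected) is the $(N+3)\times(N+3)$ matrix with entries $$\mathcal{L}_{11}=\gamma_2\rho_{22},\quad \mathcal{L}_{22}=-\gamma_2\rho_{22},\quad \mathcal{L}_{2k}=-\tfrac{\gamma_2}{2}\rho_{2k},\ \ \mathcal{L}_{k2}=-\tfrac{\gamma_2}{2}\rho_{k2}\ \text{ for all } k\ne 2,$$ and all other entries equal to $0$. The quantity $\Gamma$ is related to the electromagnetically induced transparency (EIT) linewidth.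
   Formalization: For N≥2 with some Ω_n≠0 the steady state is not unique (dark superpositions of levels 4..N+3 are stationary with ρ_12=0); the formula is proved for steady states with no population in these dark superpositions, and such a steady state is shown to exist. *)

(* Defs.v *)
From HB Require Import structures.
From mathcomp Require Export all_boot all_order all_algebra.
From mathcomp Require Export complex.
From mathcomp Require Export all_classical all_reals all_analysis.
Export Order.TTheory GRing.Theory Num.Theory.
Export numFieldNormedType.Exports.

Set Implicit Arguments.
Unset Strict Implicit.
Unset Printing Implicit Defensive.

Local Open Scope ring_scope.
Local Open Scope sesquilinear_scope.
Local Open Scope complex_scope.

(* The N + 3 levels are indexed by 'I_(3 + N): level k = 1, 2, 3 has index k - 1
   and the level n + 3 (n = 1, ..., N), reached by the n-th radio-frequency
   band, has index rshift 3 (n - 1). *)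
Definition lvl1 (N : nat) : 'I_(3 + N) := lshift N (@Ordinal 3 0 isT).
Definition lvl2 (N : nat) : 'I_(3 + N) := lshift N (@Ordinal 3 1 isT).
Definition lvl3 (N : nat) : 'I_(3 + N) := lshift N (@Ordinal 3 2 isT).
Definition lvlRF (N : nat) (n : 'I_N) : 'I_(3 + N) := rshift 3 n.

Definition density_matrix (R : realType) (d : nat) (rho : 'M[R[i]]_d) : Prop :=
  [/\ rho \is hermsymmx,
      forall v : 'cV[R[i]]_d, 0 <= (v ^t* *m rho *m v) 0 0
    & \tr rho = 1].

Definition coupling (R : realType) (d : nat) (hbar w : R) (i k : 'I_d) :
    'M[R[i]]_d :=
  (hbar / 2 * w)%:C *: (delta_mx i k + delta_mx k i).

Definition hamiltonian (R : realType) (N : nat) (hbar Op Oc : R)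
    (Om : 'I_N -> R) : 'M[R[i]]_(3 + N) :=
  coupling hbar Op (lvl1 N) (lvl2 N) + coupling hbar Oc (lvl2 N) (lvl3 N)
  + \sum_(n < N) coupling hbar (Om n) (lvl3 N) (lvlRF n).

Definition relaxation (R : realType) (N : nat) (gamma2 : R)
    (rho : 'M[R[i]]_(3 + N)) : 'M[R[i]]_(3 + N) :=
  \matrix_(i, k)
    if (i == lvl1 N) && (k == lvl1 N) then gamma2%:C * rho (lvl2 N) (lvl2 N)
    else if (i == lvl2 N) && (k == lvl2 N) then
      - (gamma2%:C * rho (lvl2 N) (lvl2 N))
    else if (i == lvl2 N) || (k == lvl2 N) then - ((gamma2 / 2)%:C * rho i k)
    else 0.

Definition lindblad_rhs (R : realType) (N : nat) (hbar gamma2 Op Oc : R)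
    (Om : 'I_N -> R) (rho : 'M[R[i]]_(3 + N)) : 'M[R[i]]_(3 + N) :=
  let H := hamiltonian hbar Op Oc Om in
  ('i%C / hbar%:C) *: (rho *m H - H *m rho) + relaxation gamma2 rho.

(* The time derivative of a matrix-valued trajectory is taken entrywise, on the
   real and imaginary parts, the time being a real variable. *)
Definition master_equation (R : realType) (N : nat) (hbar gamma2 Op Oc : R)
    (Om : 'I_N -> R) (rho : R -> 'M[R[i]]_(3 + N)) : Prop :=
  forall (t : R) (i k : 'I_(3 + N)),
    is_derive t 1 (fun s => complex.Re (rho s i k))
      (complex.Re (lindblad_rhs hbar gamma2 Op Oc Om (rho t) i k)) /\
    is_derive t 1 (fun s => complex.Im (rho s i k))
      (complex.Im (lindblad_rhs hbar gamma2 Op Oc Om (rho t) i k)).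

Definition steady_state (R : realType) (N : nat) (hbar gamma2 Op Oc : R)
    (Om : 'I_N -> R) (rho : 'M[R[i]]_(3 + N)) : Prop :=
  density_matrix rho /\ master_equation hbar gamma2 Op Oc Om (fun=> rho).

(* The radio-frequency bands only drive the bright superposition b of the levels
   4, ..., N + 3, with amplitudes proportional to Om.  The superpositions of
   these levels orthogonal to b are dark: they are annihilated by the
   Hamiltonian and by the relaxation, hence are never populated by an atom
   starting in the levels 1, 2, 3.  A density matrix has no dark population when
   the total population of the levels 4, ..., N + 3 equals the population of b,
   namely (\sum_(n, m) Om n * Om m * rho_(n+3, m+3)) / (\sum_n Om n ^+ 2).
   Multiplying out the denominator makes the condition an identity, satisfied
   by every rho, when N = 1 or when all the Om n vanish.  When N >= 2 and some
   Om n != 0, a normalised dark superposition is itself a stationary state, with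
   zero coherence, so a steady state is not unique without this condition. *)
Definition no_dark_population (R : realType) (N : nat) (Om : 'I_N -> R)
    (rho : 'M[R[i]]_(3 + N)) : Prop :=
  (\sum_(n < N) Om n ^+ 2)%:C * (\sum_(n < N) rho (lvlRF n) (lvlRF n))
  = \sum_(n < N) \sum_(m < N) (Om n * Om m)%:C * rho (lvlRF n) (lvlRF m).

Definition rho0 (R : realType) (gamma2 Op : R) : R :=
  gamma2 * Op / (gamma2 ^+ 2 + 2 * Op ^+ 2).

Definition Gamma (R : realType) (gamma2 Op Oc : R) : R :=
  Num.sqrt (2 * Op ^+ 2 * (Oc ^+ 2 + Op ^+ 2) / (gamma2 ^+ 2 + 2 * Op ^+ 2)).

(* Main.v *)
(* In a steady state the levels 4, ..., N + 3 enter only through the weighted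
   coherences X_k = \sum_n Om_n rho_{k, n+3} with k = 1, 2, 3 and through
   B = \sum_{n, m} Om_n Om_m rho_{n+3, m+3}.  Summing the stationarity equations
   against Om gives a linear system for these aggregates and the upper 3 x 3
   block; the absence of dark population turns B into \sum_n Om_n ^ 2 times the
   population of the levels 4, ..., N + 3, so that the trace condition closes the
   system.  It forces rho_23 = X_3 = 0, makes rho_12 purely imaginary, and
   expresses every population as a multiple of Im rho_12.
   Conversely, solving the system with rho_{n+3, m+3} proportional to Om_n Om_m
   yields a matrix that is a nonnegative combination of four rank-one
   projections, hence, after normalisation, a steady state. *)
Require Import Defs.
From mathcomp Require Import ring lra.

Set Implicit Arguments.
Unset Strict Implicit.
Unset Printing Implicit Defensive.

Local Open Scope ring_scope.
Local Open Scope sesquilinear_scope.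
Local Open Scope complex_scope.

(** * Case analysis, sums and functions on the levels *)

Lemma level_ind (N : nat) (P : 'I_(3 + N) -> Prop) :
  P (lvl1 N) -> P (lvl2 N) -> P (lvl3 N) -> (forall n, P (lvlRF n)) ->
  forall i, P i.
Proof.
move=> P1 P2 P3 PRF i; case: (split_ordP i) => [[[|[|[|//]]] lt_k] ->|n ->].
- by have -> : Ordinal lt_k = Ordinal (isT : 0 < 3)%N by apply: val_inj.
- by have -> : Ordinal lt_k = Ordinal (isT : 1 < 3)%N by apply: val_inj.
- by have -> : Ordinal lt_k = Ordinal (isT : 2 < 3)%N by apply: val_inj.
- exact: PRF.
Qed.

Lemma sum_levels (V : zmodType) (N : nat) (F : 'I_(3 + N) -> V) :
  \sum_i F i = F (lvl1 N) + F (lvl2 N) + F (lvl3 N) + \sum_(n < N) F (lvlRF n).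
Proof.
rewrite big_split_ord /=; congr (_ + _).
rewrite !big_ord_recl big_ord0 addr0 addrA.
by congr (F _ + F _ + F _); apply: val_inj.
Qed.

Lemma lvl_eqE (N : nat) :
  ((lvl1 N == lvl2 N) = false) * ((lvl2 N == lvl1 N) = false) *
  ((lvl1 N == lvl3 N) = false) * ((lvl3 N == lvl1 N) = false) *
  ((lvl2 N == lvl3 N) = false) * ((lvl3 N == lvl2 N) = false) *
  (forall n, (lvl1 N == lvlRF n) = false) *
  (forall n, (lvlRF n == lvl1 N) = false) *
  (forall n, (lvl2 N == lvlRF n) = false) *
  (forall n, (lvlRF n == lvl2 N) = false) *
  (forall n, (lvl3 N == lvlRF n) = false) *
  (forall n, (lvlRF n == lvl3 N) = false) *
  (forall n m : 'I_N, (lvlRF n == lvlRF m) = (n == m)).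
Proof. by do !split=> *; rewrite // eq_rshift. Qed.

(** The default [a1] of [nth] is never reached, since [j] ranges over three indices. *)
Definition of_levels (V : Type) (N : nat) (a1 a2 a3 : V) (a : 'I_N -> V)
    (k : 'I_(3 + N)) : V :=
  match fintype.split k with inl j => nth a1 [:: a1; a2; a3] j | inr n => a n end.

Lemma of_levelsE (V : Type) (N : nat) (a1 a2 a3 : V) (a : 'I_N -> V) :
  (of_levels a1 a2 a3 a (lvl1 N) = a1) * (of_levels a1 a2 a3 a (lvl2 N) = a2) *
  (of_levels a1 a2 a3 a (lvl3 N) = a3) *
  (forall n, of_levels a1 a2 a3 a (lvlRF n) = a n).
Proof.
have splitL j : fintype.split (lshift N j : 'I_(3 + N)) = inl j by exact: (unsplitK (inl j)).
have splitR n : fintype.split (rshift 3 n : 'I_(3 + N)) = inr n by exact: (unsplitK (inr n)).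
by do ![split] => [|||n]; rewrite /of_levels ?splitL ?splitR.
Qed.

(** * The Hamiltonian's action and the entrywise stationarity equations *)

(* The action of the Hamiltonian on a vector, up to the factor hbar / 2. *)
Definition driven (R : realType) (N : nat) (Op Oc : R) (Om : 'I_N -> R)
    (x : 'I_(3 + N) -> R[i]) : 'I_(3 + N) -> R[i] :=
  of_levels (Op%:C * x (lvl2 N)) (Op%:C * x (lvl1 N) + Oc%:C * x (lvl3 N))
    (Oc%:C * x (lvl2 N) + \sum_(n < N) (Om n)%:C * x (lvlRF n))
    (fun n => (Om n)%:C * x (lvl3 N)).

Lemma mulmx_coupling (R : realType) (m d : nat) (hbar w : R) (i k : 'I_d)
    (A : 'M[R[i]]_(m, d)) r s :
  (A *m coupling hbar w i k) r s =
  (hbar / 2)%:C * (w%:C * (A r i * (k == s)%:R + A r k * (i == s)%:R)).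
Proof.
rewrite /coupling -scalemxAr mxE mulmxDr !mxE rmorphM -mulrA; congr (_ * (_ * (_ + _))).
  rewrite (bigD1 i) //= mxE eqxx /= big1 ?addr0 1?eq_sym //.
  by move=> j ji; rewrite mxE (negbTE ji) mulr0.
rewrite (bigD1 k) //= mxE eqxx /= big1 ?addr0 1?eq_sym //.
by move=> j ji; rewrite mxE (negbTE ji) mulr0.
Qed.

Lemma mulmx_hamiltonian (R : realType) (m N : nat) (hbar Op Oc : R)
    (Om : 'I_N -> R) (A : 'M[R[i]]_(m, 3 + N)) r s :
  (A *m hamiltonian hbar Op Oc Om) r s =
  (hbar / 2)%:C * driven Op Oc Om (A r) s.
Proof.
rewrite /hamiltonian !mulmxDr mulmx_sumr mxE mxE !mulmx_coupling summxE.
under eq_bigr => n _ do rewrite mulmx_coupling.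
rewrite -mulr_sumr -!mulrDr; congr (_ * _).
move: s; apply: level_ind => [|||n]; rewrite /driven of_levelsE ?eqxx ?lvl_eqE /=.
- by rewrite big1 => [|n _]; ring.
- by rewrite big1 => [|n _]; ring.
- by under eq_bigr => n _ do rewrite mulr0 mulr1 add0r; ring.
- rewrite (bigD1 n) //= lvl_eqE eqxx big1 => [|k kn]; first by rewrite /=; ring.
  by rewrite lvl_eqE (negbTE kn) /=; ring.
Qed.

(** The Hamiltonian equals its plain transpose, so left multiplication reduces to right
    multiplication, with no conjugation. *)
Lemma hamiltonian_mulmx (R : realType) (m N : nat) (hbar Op Oc : R)
    (Om : 'I_N -> R) (A : 'M[R[i]]_(3 + N, m)) r s :
  (hamiltonian hbar Op Oc Om *m A) r s =
  (hbar / 2)%:C * driven Op Oc Om (A^~ s) r.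
Proof.
have HT : (hamiltonian hbar Op Oc Om)^T = hamiltonian hbar Op Oc Om.
  have cT i k w : (coupling hbar w i k)^T = coupling hbar w i k :> 'M[R[i]]_(3 + N).
    by rewrite /coupling linearZ linearD /= !trmx_delta addrC.
  rewrite /hamiltonian !linearD /= !cT linear_sum /=.
  by congr (_ + _); apply: eq_bigr => n _; rewrite cT.
rewrite -[hamiltonian _ _ _ _ *m A]trmxK trmx_mul HT mxE mulmx_hamiltonian.
by congr (_ * driven _ _ _ _ _); apply/funext => k; rewrite mxE.
Qed.

(** A constant trajectory has derivative zero, and derivatives are unique; one instant suffices. *)
Lemma master_equation_cstP (R : realType) (N : nat) (hbar gamma2 Op Oc : R)
    (Om : 'I_N -> R) (rho : 'M[R[i]]_(3 + N)) :
  master_equation hbar gamma2 Op Oc Om (fun=> rho) <->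
  lindblad_rhs hbar gamma2 Op Oc Om rho = 0.
Proof.
split=> [eq0|eq0 t i k]; last first.
  by rewrite eq0 mxE /=; split; exact: is_derive_cst.
apply/matrixP => i k; have [dRe dIm] := eq0 0 i k; rewrite [RHS]mxE.
have := @derive_val _ _ _ _ _ _ _ dRe; rewrite derive_cst => Re0.
have := @derive_val _ _ _ _ _ _ _ dIm; rewrite derive_cst => Im0.
by apply/eqP; rewrite eq_complex -Re0 -Im0 !eqxx.
Qed.

Lemma lindblad_rhsE (R : realType) (N : nat) (hbar gamma2 Op Oc : R)
    (Om : 'I_N -> R) (rho : 'M[R[i]]_(3 + N)) i k : hbar != 0 ->
  lindblad_rhs hbar gamma2 Op Oc Om rho i k =
  'i%C / 2 * (driven Op Oc Om (rho i) k - driven Op Oc Om (rho^~ k) i)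
  + relaxation gamma2 rho i k.
Proof.
move=> hbar0; rewrite /lindblad_rhs mxE [in LHS]mxE; congr (_ + _).
rewrite [in LHS]mxE [X in _ + X]mxE mulmx_hamiltonian hamiltonian_mulmx.
rewrite rmorphM fmorphV rmorph_nat.
by field; rewrite fmorph_eq0.
Qed.

(** * The real linear system satisfied by a steady state *)

(* Here r_kk, x_kl + i y_kl are the entries of rho among the levels 1, 2, 3, P is
   the total population of the other levels, S = \sum_n Om_n ^ 2, and X_k + i Y_k
   is the weighted coherence \sum_n Om_n rho_{k, n+3}. *)
Lemma probe_coherence (R : realFieldType) (g p c S r11 r22 r33 P : R)
    (x12 y12 x13 y13 x23 y23 X1 Y1 X2 Y2 X3 Y3 : R) :
  0 < g -> 0 < p -> 0 < c -> 0 <= S ->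
  p * y12 = g * r22 ->
  - (c * y13) = g * x12 -> p * r11 + c * x13 - p * r22 = g * y12 ->
  c * x12 + X1 = p * x23 -> c * y12 + Y1 = p * y23 ->
  p * y13 - Y2 = g * x23 -> c * r22 + X2 - p * x13 - c * r33 = g * y23 ->
  Y3 = c * y23 ->
  S * x13 = p * X2 -> S * y13 = p * Y2 ->
  p * Y1 + c * Y3 - S * y23 = g * X2 ->
  S * r33 = c * X2 + S * P -> c * Y2 = 0 ->
  S * Y3 = 0 ->
  (S = 0 -> [/\ X1 = 0, Y1 = 0, X2 = 0, Y2 = 0 & Y3 = 0]) ->
  r11 + r22 + r33 + P = 1 ->
  x12 = 0 /\
  y12 * (S * (g ^+ 2 + 2 * p ^+ 2) + 2 * p ^+ 2 * (c ^+ 2 + p ^+ 2)) =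
    g * p * S.
Proof.
move=> g0 p0 c0 S0 e11 e12x e12y e13x e13y e23x e23y e33 f1x f1y f2 f3x f3y fRF.
have [gN0 pN0 cN0] : [/\ g != 0, p != 0 & c != 0] by split; rewrite gt_eqF.
have zero (a b : R) : a != 0 -> a * b = 0 -> b = 0.
  by move=> aN0 /eqP; rewrite mulf_eq0 (negbTE aN0) => /eqP.
move=> dec trace1; move: S0; rewrite le0r => /orP[/eqP S0|S0].
  (* Case [S = 0]: the weighted coherences vanish, so [e33] gives [y23 = 0] and then [e13y] gives
     [y12 = 0]. *)
  have [X10 Y10 X20 Y20 Y30] := dec S0.
  have y230 : y23 = 0 by apply: (zero c) => //; rewrite -e33.
  have y120 : y12 = 0.
    by apply: (zero c) => //; move: e13y; rewrite y230 Y10 mulr0 addr0.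
  split; last by rewrite y120 S0; ring.
  (* Eliminating [x23] and [y13] from [e12x], [e13x] and [e23x] leaves this positive multiple of
     [x12]. *)
  apply: (zero (p ^+ 2 + c ^+ 2)); first by rewrite gt_eqF ?addr_gt0 ?exprn_gt0.
  apply: (zero g) => //.
  have -> : g * ((p ^+ 2 + c ^+ 2) * x12) =
      p ^+ 2 * (g * x12) + g * c * (c * x12) by ring.
  have -> : c * x12 = p * x23 by rewrite -e13x X10 addr0.
  rewrite -e12x.
  have -> : g * c * (p * x23) = c * p * (g * x23) by ring.
  by rewrite -e23x Y20; ring.
(* Case [0 < S]: the homogeneous equations kill [Y3], [y23], [Y2], [y13] and [x12] in turn; the
   remaining unknowns are then multiples of [y12]. *)
have SN0 : S != 0 by rewrite gt_eqF.
have Y30 : Y3 = 0 := zero _ _ SN0 fRF.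
have y230 : y23 = 0 by apply: (zero c) => //; rewrite -e33.
have Y20 : Y2 = 0 := zero _ _ cN0 f3y.
have y130 : y13 = 0 by apply: (zero S) => //; rewrite f1y Y20 mulr0.
have x120 : x12 = 0 by apply: (zero g) => //; rewrite -e12x y130 mulr0 oppr0.
split=> //.
have Y1E : Y1 = - c * y12 by move: e13y; rewrite y230; lra.
have r22E : r22 = p * y12 / g by rewrite e11; field.
have X2E : X2 = - (p * c * y12) / g.
  by apply: (mulfI gN0); rewrite -f2 Y1E Y30 y230; field.
have x13E : x13 = - (p ^+ 2 * c * y12) / (g * S).
  by apply: (mulfI SN0); rewrite f1x X2E; field; rewrite gN0 SN0.
have r11E : r11 = (g * y12 - c * x13 + p * r22) / p.
  by apply: (mulfI pN0); rewrite -e12y; field.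
have r33E : r33 = (c * r22 + X2 - p * x13) / c.
  by apply: (mulfI cN0); move: e23y; rewrite y230 => e23y;
    rewrite mulrCA divff //; lra.
have PE : P = r33 - c * X2 / S.
  by apply: (mulfI SN0); rewrite mulrBr f3x; field.
(* Only the trace condition is inhomogeneous: it fixes the scale, hence [y12]. *)
have : g * p * S * (r11 + r22 + r33 + P) = g * p * S by rewrite trace1 mulr1.
by rewrite PE r11E r33E x13E X2E r22E => <-; field; rewrite gN0 pN0 cN0 SN0.
Qed.

(* Also true when S = 0, as then w m = 0. *)
Lemma sqr_sum_divK (R : realFieldType) (N : nat) (w : 'I_N -> R) m :
  let S := \sum_(n < N) w n ^+ 2 in w m / S * S = w m.
Proof.
move=> S; have [S0|SN0] := eqVneq S 0; last by rewrite divfK.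
rewrite S0 mulr0; apply/esym/eqP; rewrite -sqrf_eq0; apply/eqP.
by apply: (psumr_eq0P _ S0) => // n _; exact: sqr_ge0.
Qed.

(** * From the matrix equation to the real system *)

Lemma complex_components (R : realType) (z z' : R[i]) :
  z = z' -> complex.Re z = complex.Re z' /\ complex.Im z = complex.Im z'.
Proof. by move=> ->. Qed.

Lemma density_matrix_conj (R : realType) (d : nat) (rho : 'M[R[i]]_d) i k :
  density_matrix rho -> rho k i = (rho i k)^*%C.
Proof.
by case=> /is_hermitianmxP /matrixP /(_ k i) + _ _; rewrite expr0 scale1r !mxE.
Qed.

Lemma denominator_gt0 (R : realFieldType) (g p c S : R) : 0 < p -> 0 <= S ->
  0 < S * (g ^+ 2 + 2 * p ^+ 2) + 2 * p ^+ 2 * (c ^+ 2 + p ^+ 2).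
Proof.
move=> p0 S0; have pp0 : 0 < 2 * p ^+ 2 by rewrite mulr_gt0 ?exprn_gt0.
rewrite ltr_wpDl ?mulr_gt0 ?ltr_wpDl ?exprn_gt0 ?sqr_ge0 //.
by rewrite mulr_ge0 // addr_ge0 ?sqr_ge0 // ltW.
Qed.

(** The final formula with numerator and denominator multiplied by [gamma2 ^+ 2 + 2 * Op ^+ 2],
    which avoids the square root. *)
Lemma steady_coherence (R : realType) (N : nat) (hbar gamma2 Op Oc : R)
    (Om : 'I_N -> R) (rho : 'M[R[i]]_(3 + N)) :
  0 < hbar -> 0 < gamma2 -> 0 < Op -> 0 < Oc ->
  density_matrix rho -> lindblad_rhs hbar gamma2 Op Oc Om rho = 0 ->
  no_dark_population Om rho ->
  let S := \sum_(n < N) Om n ^+ 2 in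
  rho (lvl1 N) (lvl2 N) = 'i%C * (gamma2 * Op * S /
    (S * (gamma2 ^+ 2 + 2 * Op ^+ 2) + 2 * Op ^+ 2 * (Oc ^+ 2 + Op ^+ 2)))%:C.
Proof.
move=> hbar0 g0 p0 c0 dm rhs0 dark S.
have herm i k : rho k i = (rho i k)^*%C by exact: density_matrix_conj.
have trace1 : \tr rho = 1 by case: dm.
have E i k : 'i%C / 2 * (driven Op Oc Om (rho i) k - driven Op Oc Om (rho^~ k) i)
    + relaxation gamma2 rho i k = 0.
  by rewrite -(@lindblad_rhsE _ _ hbar) ?gt_eqF // rhs0 mxE.
have i2N0 : 'i%C / 2 != 0 :> R[i].
  by rewrite mulf_neq0 ?invr_eq0 ?pnatr_eq0 // eq_complex /= oner_eq0 andbF.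
(* [drop_i] serves the entries without relaxation, [drop_half] those decaying at half the rate. *)
have drop_i a b : 'i%C / 2 * (a - b) + 0 = 0 -> a = b :> R[i].
  by rewrite addr0 => /eqP; rewrite mulf_eq0 (negbTE i2N0) subr_eq0 => /eqP.
have drop_half (a r : R[i]) (g : R) :
    'i%C / 2 * a - (g / 2)%:C * r = 0 -> 'i%C * a = g%:C * r.
  have -> : (g / 2)%:C = g%:C / 2 :> R[i] by rewrite rmorphM fmorphV rmorph_nat.
  move=> ar; apply/eqP; rewrite -subr_eq0; apply/eqP.
  by rewrite -[RHS](mulr0 2) -ar; field.
have SC : \sum_(n < N) (Om n)%:C * (Om n)%:C = S%:C :> R[i].
  by rewrite rmorph_sum; apply: eq_bigr => n _; rewrite expr2 rmorphM.
pose X k := \sum_(n < N) (Om n)%:C * rho k (lvlRF n).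
have XJ k : \sum_(n < N) (Om n)%:C * rho (lvlRF n) k = (X k)^*%C.
  rewrite rmorph_sum; apply: eq_bigr => n _.
  by rewrite herm rmorphM /= oppr0.
pose P := \sum_(n < N) rho (lvlRF n) (lvlRF n).
pose B := \sum_(n < N) \sum_(m < N) (Om n * Om m)%:C * rho (lvlRF n) (lvlRF m).
have nd : S%:C * P = B by exact: dark.
have := E (lvl1 N) (lvl1 N);
  rewrite /driven !of_levelsE mxE !eqxx /= => e11.
have := E (lvl1 N) (lvl2 N);
  rewrite /driven !of_levelsE mxE !eqxx !lvl_eqE /= => /drop_half e12.
have := E (lvl1 N) (lvl3 N);
  rewrite /driven !of_levelsE mxE !eqxx !lvl_eqE /= -/(X _) => /drop_i e13.
have := E (lvl2 N) (lvl3 N);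
  rewrite /driven !of_levelsE mxE !eqxx !lvl_eqE /= -/(X _) => /drop_half e23.
have := E (lvl3 N) (lvl3 N);
  rewrite /driven !of_levelsE mxE !lvl_eqE /= -/(X _) XJ => /drop_i e33.
(* [f1], [f2] and [f3] are the equations at [(k, n+3)], for [k = 1, 2, 3], summed against [Om n]. *)
have f1 : S%:C * rho (lvl1 N) (lvl3 N) = Op%:C * X (lvl2 N).
  rewrite -SC mulr_suml mulr_sumr; apply: eq_bigr => n _.
  have := E (lvl1 N) (lvlRF n).
  rewrite /driven !of_levelsE mxE !eqxx !lvl_eqE /= => /drop_i e1n.
  by rewrite -mulrA e1n mulrCA.
have f2 : 'i%C * (S%:C * rho (lvl2 N) (lvl3 N)
      - Op%:C * X (lvl1 N) - Oc%:C * X (lvl3 N)) = gamma2%:C * X (lvl2 N).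
  rewrite -SC mulr_suml /X [Op%:C * _]mulr_sumr [Oc%:C * _]mulr_sumr.
  rewrite -!sumrB !mulr_sumr.
  apply: eq_bigr => n _; have := E (lvl2 N) (lvlRF n).
  rewrite /driven !of_levelsE mxE !eqxx !lvl_eqE /= => /drop_half e2n.
  by rewrite [in RHS]mulrCA -e2n; ring.
have f3 : S%:C * rho (lvl3 N) (lvl3 N) = Oc%:C * X (lvl2 N) + B.
  rewrite /B exchange_big -SC mulr_suml mulr_sumr -big_split /=.
  apply: eq_bigr => n _; have := E (lvl3 N) (lvlRF n).
  rewrite /driven !of_levelsE mxE !lvl_eqE /= => /drop_i e3n.
  rewrite -mulrA e3n mulrDr mulrCA; congr (_ + _); rewrite mulr_sumr.
  by apply: eq_bigr => m _; rewrite rmorphM mulrCA mulrA.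
(* The equations between radio-frequency levels, summed against [Om n * Om m]; for nonzero [S] they
   make [X_3] real. *)
have fRF : S%:C * X (lvl3 N) = S%:C * (X (lvl3 N))^*%C.
  rewrite -XJ -SC !mulr_suml.
  under eq_bigr => n _ do rewrite mulr_sumr.
  under [RHS]eq_bigr => n _ do rewrite mulr_sumr.
  rewrite exchange_big; apply: eq_bigr => m _; apply: eq_bigr => n _.
  have := E (lvlRF n) (lvlRF m).
  rewrite /driven !of_levelsE mxE !lvl_eqE /= => /drop_i eRF.
  by rewrite [RHS]mulrACA eRF; ring.
(* Each [Om n] is a multiple of [S] by [sqr_sum_divK]. *)
have X0 k : S = 0 -> X k = 0.
  move=> S0; apply: big1 => n _.
  by rewrite -(sqr_sum_divK Om n) -/S S0 mulr0 mul0r.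
move: trace1; rewrite /mxtrace sum_levels -/P => trace1.
(* Level 1 gains population at the full rate, hence the coefficient [- gamma2 * 2] in the pattern of
   [drop_half]. *)
have {}e11 : 'i%C * (Op%:C * rho (lvl1 N) (lvl2 N) - Op%:C * rho (lvl2 N) (lvl1 N))
    = (- gamma2 * 2)%:C * rho (lvl2 N) (lvl2 N).
  by apply: drop_half; rewrite mulfK ?pnatr_eq0 // -[RHS]e11 rmorphN mulNr opprK.
rewrite (herm (lvl1 N) (lvl2 N)) in e11; rewrite (herm (lvl2 N) (lvl3 N)) in e33.
rewrite -{}nd in f3.
have S0 : 0 <= S by apply: sumr_ge0 => n _; exact: sqr_ge0.
move: (X0 (lvl1 N)) (X0 (lvl2 N)) (X0 (lvl3 N)).
move: (herm (lvl1 N) (lvl1 N)) (herm (lvl2 N) (lvl2 N)) (herm (lvl3 N) (lvl3 N)).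
move: e11 e12 e13 e23 e33 f1 f2 f3 fRF trace1.
case: (rho (lvl1 N) (lvl1 N)) (rho (lvl2 N) (lvl2 N)) (rho (lvl3 N) (lvl3 N)) P
  (rho (lvl1 N) (lvl2 N)) (rho (lvl1 N) (lvl3 N)) (rho (lvl2 N) (lvl3 N))
  (X (lvl1 N)) (X (lvl2 N)) (X (lvl3 N)) => [r11 s11] [r22 s22] [r33 s33] [P sP]
  [x12 y12] [x13 y13] [x23 y23] [X1 Y1] [X2 Y2] [X3 Y3].
move=> /complex_components /= [e11x e11y].
move=> /complex_components /= [e12x e12y].
move=> /complex_components /= [e13x e13y].
move=> /complex_components /= [e23x e23y].
move=> /complex_components /= [e33x e33y].
move=> /complex_components /= [f1x f1y].
move=> /complex_components /= [f2x f2y].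
move=> /complex_components /= [f3x f3y].
move=> /complex_components /= [fRFx fRFy].
move=> /complex_components /= [trx tr_y].
move=> /complex_components /= [d1x d1y].
move=> /complex_components /= [d2x d2y].
move=> /complex_components /= [d3x d3y].
(* Hermiticity makes the three diagonal entries real; the trace then makes the remaining population
   real. *)
have s110 : s11 = 0 by lra.
have s220 : s22 = 0 by lra.
have s330 : s33 = 0 by lra.
have sP0 : sP = 0 by lra.
subst s11 s22 s33 sP.
move=> X10 X20 X30.
have dec : S = 0 -> [/\ X1 = 0, Y1 = 0, X2 = 0, Y2 = 0 & Y3 = 0].
  by move=> /[dup] /[dup] /X10 [-> ->] /X20 [-> ->] /X30 [_ ->].
have [-> y12E] : x12 = 0 /\ y12 * (S * (gamma2 ^+ 2 + 2 * Op ^+ 2)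
    + 2 * Op ^+ 2 * (Oc ^+ 2 + Op ^+ 2)) = gamma2 * Op * S.
  by apply: (@probe_coherence _ gamma2 Op Oc S r11 r22 r33 P x12 y12 x13 y13
    x23 y23 X1 Y1 X2 Y2 X3 Y3) => //; lra.
rewrite -y12E mulfK; last first.
  by rewrite gt_eqF ?denominator_gt0.
by apply/eqP; rewrite eq_complex /=; apply/andP; split; apply/eqP; ring.
Qed.

(** * Positive semidefinite matrices and normalisation *)

(** Leaving out the trace condition gives a cone, closed under nonnegative combinations. *)
Definition psdmx (R : realType) (d : nat) (A : 'M[R[i]]_d) : Prop :=
  A \is hermsymmx /\ forall v : 'cV[R[i]]_d, 0 <= (v ^t* *m A *m v) 0 0.

(** The quadratic form at [v] is the squared modulus of the inner product of [v] and [u]. *)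
Lemma psdmx_ketbra (R : realType) (d : nat) (u : 'cV[R[i]]_d) :
  psdmx (u *m u ^t*).
Proof.
have adjK m n (A : 'M[R[i]]_(m, n)) : A ^t* ^t* = A.
  by apply/matrixP => i k; rewrite !mxE conjCK.
split=> [|v].
  by apply/is_hermitianmxP; rewrite expr0 scale1r trmx_mul map_mxM adjK.
have -> : v ^t* *m (u *m u ^t*) *m v = (v ^t* *m u) *m (v ^t* *m u) ^t*.
  by rewrite trmx_mul map_mxM adjK !mulmxA.
by move: (v ^t* *m u) => x; rewrite mxE big_ord1 !mxE mul_conjC_ge0.
Qed.

Lemma psdmxD (R : realType) (d : nat) (A B : 'M[R[i]]_d) :
  psdmx A -> psdmx B -> psdmx (A + B).
Proof.
move=> [/is_hermitianmxP hA pA] [/is_hermitianmxP hB pB]; split=> [|v].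
  by apply/is_hermitianmxP; rewrite linearD map_mxD scalerDr -hA -hB.
by rewrite mulmxDr mulmxDl mxE addr_ge0.
Qed.

Lemma psdmxZ (R : realType) (d : nat) (a : R[i]) (A : 'M[R[i]]_d) :
  0 <= a -> psdmx A -> psdmx (a *: A).
Proof.
move=> a0 [/is_hermitianmxP hA pA]; split=> [|v].
  apply/is_hermitianmxP.
  by rewrite linearZ map_mxZ /= (geC0_conj a0) scalerA mulrC -scalerA -hA.
by rewrite -scalemxAr -scalemxAl mxE mulr_ge0.
Qed.

Lemma density_matrix_normalize (R : realType) (d : nat) (A : 'M[R[i]]_d) :
  psdmx A -> 0 < \tr A -> density_matrix ((\tr A)^-1 *: A).
Proof.
move=> pA tA; have [] : psdmx ((\tr A)^-1 *: A).
  by apply: psdmxZ => //; rewrite invr_ge0 ltW.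
by split=> //; rewrite mxtraceZ mulVf // gt_eqF.
Qed.

(** Homogeneity allows stationarity to be checked before dividing by the trace. *)
Lemma lindblad_rhsZ (R : realType) (N : nat) (hbar gamma2 Op Oc : R)
    (Om : 'I_N -> R) (a : R[i]) (rho : 'M[R[i]]_(3 + N)) :
  lindblad_rhs hbar gamma2 Op Oc Om (a *: rho) =
  a *: lindblad_rhs hbar gamma2 Op Oc Om rho.
Proof.
rewrite /lindblad_rhs [RHS]scalerDr; congr (_ + _).
  by rewrite -scalemxAl -scalemxAr -scalerBr !scalerA mulrC.
by apply/matrixP => i k; rewrite !mxE; do ?[case: ifP => _]; ring.
Qed.

Lemma no_dark_populationZ (R : realType) (N : nat) (Om : 'I_N -> R) (a : R[i])
    (rho : 'M[R[i]]_(3 + N)) :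
  no_dark_population Om rho -> no_dark_population Om (a *: rho).
Proof.
rewrite /no_dark_population => dark.
have -> : \sum_(n < N) (a *: rho) (lvlRF n) (lvlRF n) =
    a * \sum_(n < N) rho (lvlRF n) (lvlRF n).
  by rewrite mulr_sumr; apply: eq_bigr => n _; rewrite mxE.
rewrite mulrCA dark mulr_sumr; apply: eq_bigr => n _.
by rewrite mulr_sumr; apply: eq_bigr => m _; rewrite mxE mulrCA.
Qed.

(** * An explicit steady state *)

(* Up to a positive factor, the solution of the stationarity equations with
   g, p, c, w = gamma2, Op, Oc, Om; when S = 0 it is the pure state c e_1 - p e_3,
   thanks to x / 0 = 0. *)
Definition stationary_mx (R : realType) (N : nat) (g p c : R) (w : 'I_N -> R) :
    'M[R[i]]_(3 + N) :=
  let S := \sum_(n < N) w n ^+ 2 in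
  \matrix_(i, k) of_levels
    (of_levels (S * g ^+ 2 + p ^+ 2 * S + p ^+ 2 * c ^+ 2)%:C
      ('i%C * (p * g * S)%:C) (- (p ^+ 3 * c))%:C
      (fun n => - 'i%C * (p * g * c * w n)%:C) k)
    (of_levels (- 'i%C * (p * g * S)%:C) (p ^+ 2 * S)%:C 0
      (fun n => (- (p ^+ 2 * c * w n))%:C) k)
    (of_levels (- (p ^+ 3 * c))%:C 0 (p ^+ 4)%:C (fun=> 0) k)
    (fun m => of_levels ('i%C * (p * g * c * w m)%:C) (- (p ^+ 2 * c * w m))%:C 0
      (fun n => (p ^+ 2 * (c ^+ 2 + p ^+ 2) * (w m * w n / S))%:C) k) i.

(* The matrix is S u u^* + p^2 S e_1 e_1^* + p^2 v v^* + p^4 S q q^*, where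
   q = \sum_n (w n / S) e_{n+3}, u = i g e_1 + p e_2 - p c q, v = c e_1 - p e_3. *)
Lemma stationary_mx_psd (R : realType) (N : nat) (g p c : R) (w : 'I_N -> R) :
  psdmx (stationary_mx g p c w).
Proof.
pose S := \sum_(n < N) w n ^+ 2; pose q n := w n / S.
have S0 : 0 <= S by apply: sumr_ge0 => n _; exact: sqr_ge0.
have Sq n : S * q n = w n by rewrite mulrC; exact: sqr_sum_divK.
pose ket (a1 a2 a3 : R[i]) a : 'cV[R[i]]_(3 + N) :=
  \col_k of_levels a1 a2 a3 (fun n => (a * q n)%:C) k.
pose u1 := ket ('i%C * g%:C) p%:C 0 (- p * c).
pose u2 := ket 1 0 0 0.
pose u3 := ket c%:C 0 (- p)%:C 0.
pose u4 := ket 0 0 0 1.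
suff -> : stationary_mx g p c w = S%:C *: (u1 *m u1 ^t*)
    + (p ^+ 2 * S)%:C *: (u2 *m u2 ^t*) + (p ^+ 2)%:C *: (u3 *m u3 ^t*)
    + (p ^+ 4 * S)%:C *: (u4 *m u4 ^t*).
  have p2 : 0 <= p ^+ 2 by exact: sqr_ge0.
  have p4 : 0 <= p ^+ 4 by rewrite exprn_even_ge0.
  have [s1 s2] : 0 <= p ^+ 2 * S /\ 0 <= p ^+ 4 * S by split; exact: mulr_ge0.
  have ketP (a : R) (u : 'cV_(3 + N)) : 0 <= a -> psdmx (a%:C *: (u *m u ^t*)).
    by move=> a0; apply: psdmxZ (psdmx_ketbra u); rewrite ler0c.
  exact: (psdmxD (psdmxD (psdmxD (ketP _ _ S0) (ketP _ _ s1)) (ketP _ _ p2))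
    (ketP _ _ s2)).
have ketE (u : 'cV[R[i]]_(3 + N)) i k : (u *m u ^t*) i k = u i 0 * (u k 0)^*%C.
  by rewrite mxE big_ord1 !mxE.
apply/matrixP => i k.
have addE (A B : 'M[R[i]]_(3 + N)) : (A + B) i k = A i k + B i k by rewrite mxE.
have scaleE a (A : 'M[R[i]]_(3 + N)) : (a *: A) i k = a * A i k by rewrite mxE.
rewrite !addE !scaleE !ketE.
rewrite /u1 /u2 /u3 /u4 /ket ![(\col__ _) _ _]mxE /stationary_mx [LHS]mxE -/S.
clear addE scaleE; move: i k.
(* Written in [S] and [q], every entry is polynomial, so [ring] applies even when [S = 0]. *)
have wwE m n : w m * w n / S = S * (q m * q n) by rewrite mulrA Sq -mulrA.
by apply: level_ind => [|||m]; apply: level_ind => [|||n];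
  rewrite !of_levelsE ?wwE -?Sq; apply/eqP; rewrite eq_complex /=;
  apply/andP; split; apply/eqP; ring.
Qed.

Lemma stationary_mx_lindblad (R : realType) (N : nat) (hbar g p c : R)
    (w : 'I_N -> R) : hbar != 0 ->
  lindblad_rhs hbar g p c w (stationary_mx g p c w) = 0.
Proof.
move=> hbar0; pose S := \sum_(n < N) w n ^+ 2.
have sumw (b : R[i]) (F : 'I_N -> R[i]) : (forall n, F n = b * (w n)%:C) ->
    \sum_n (w n)%:C * F n = b * S%:C.
  move=> FE; rewrite rmorph_sum mulr_sumr; apply: eq_bigr => n _.
  by rewrite FE mulrCA -rmorphM.
have divK m : w m / S * S = w m by exact: sqr_sum_divK.
set M := stationary_mx g p c w.
(* [b k] is the common factor in [M k (lvlRF n) = b k * w n], so weighted sums over the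
   radio-frequency levels become multiples of [S]. *)
pose b := of_levels (- 'i%C * (p * g * c)%:C) (- (p ^+ 2 * c))%:C 0
  (fun m => (p ^+ 2 * (c ^+ 2 + p ^+ 2) * (w m / S))%:C).
have rowE k : \sum_n (w n)%:C * M k (lvlRF n) = b k * S%:C.
  apply: sumw => n; rewrite mxE -/S; move: k.
  by apply: level_ind => [|||m]; rewrite /b !of_levelsE; apply/eqP;
    rewrite eq_complex /=; apply/andP; split; apply/eqP; ring.
have colE k : \sum_n (w n)%:C * M (lvlRF n) k = (b k)^*%C * S%:C.
  apply: sumw => n; rewrite mxE -/S; move: k.
  by apply: level_ind => [|||m]; rewrite /b !of_levelsE; apply/eqP;
    rewrite eq_complex /=; apply/andP; split; apply/eqP; ring.
have i2 : 'i%C / 2 = 0 +i* 2^-1 :> R[i].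
  by apply: (mulIf (_ : 2 != 0)); rewrite ?pnatr_eq0 // divfK ?pnatr_eq0 //;
    apply/eqP; rewrite eq_complex /=; apply/andP; split; apply/eqP; field.
have ME i k : M i k = _ := mxE _ _ i k.
apply/matrixP => i k; rewrite lindblad_rhsE // [RHS]mxE i2.
move: i k; apply: level_ind => [|||m]; apply: level_ind => [|||n];
  rewrite /driven !of_levelsE [relaxation _ _ _ _]mxE !lvl_eqE ?eqxx /=
    ?rowE ?colE /b !ME -/S !of_levelsE;
  apply/eqP; rewrite eq_complex /= -?[_ * (_ / S) * S]mulrA ?divK;
  apply/andP; split; apply/eqP; by [ring | field].
Qed.

(** The radio-frequency block is a multiple of the rank-one matrix built on the bright direction
    [w]. *)
Lemma stationary_mx_dark (R : realType) (N : nat) (g p c : R) (w : 'I_N -> R) :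
  no_dark_population w (stationary_mx g p c w).
Proof.
pose S := \sum_(n < N) w n ^+ 2; pose a := p ^+ 2 * (c ^+ 2 + p ^+ 2).
have divK m : w m / S * S = w m by exact: sqr_sum_divK.
have MRF n m : stationary_mx g p c w (lvlRF n) (lvlRF m) = (a * (w n * w m / S))%:C.
  by rewrite mxE !of_levelsE.
rewrite /no_dark_population mulr_sumr; apply: eq_bigr => n _.
under [RHS]eq_bigr => m _ do rewrite MRF -rmorphM.
rewrite MRF -rmorphM -rmorph_sum; congr _%:C; rewrite -/S.
transitivity (a * (w n / S) * w n * S); first by ring.
by rewrite mulr_sumr; apply: eq_bigr => m _; ring.
Qed.

(** Level 3 contributes [p ^+ 4], which is positive, and the other diagonal entries are
    nonnegative. *)
Lemma stationary_mx_trace_gt0 (R : realType) (N : nat) (g p c : R)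
    (w : 'I_N -> R) :
  0 < p -> 0 < \tr (stationary_mx g p c w).
Proof.
move=> p0; pose S := \sum_(n < N) w n ^+ 2.
have S0 : 0 <= S by apply: sumr_ge0 => n _; exact: sqr_ge0.
rewrite /mxtrace sum_levels !mxE -/S !of_levelsE -!rmorphD.
have [g2 p2 c2] : [/\ 0 <= g ^+ 2, 0 <= p ^+ 2 & 0 <= c ^+ 2].
  by split; exact: sqr_ge0.
apply: ltr_pwDl.
  by rewrite ltcR ltr_wpDl ?exprn_gt0 // !addr_ge0 // mulr_ge0.
apply: sumr_ge0 => n _; rewrite !mxE !of_levelsE ler0c -/S -expr2.
by apply: mulr_ge0; [apply: mulr_ge0 => //; exact: addr_ge0 | rewrite divr_ge0 ?sqr_ge0].
Qed.

Theorem theorem1 (R : realType) (N : nat) (hbar gamma2 Op Oc : R)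
    (Om : 'I_N -> R) :
  (1 <= N)%N ->
  0 < hbar -> 0 < gamma2 -> 0 < Op -> 0 < Oc -> (forall n, 0 <= Om n) ->
  (exists rho : 'M[R[i]]_(3 + N),
     steady_state hbar gamma2 Op Oc Om rho /\ no_dark_population Om rho) /\
  (forall rho : 'M[R[i]]_(3 + N),
     steady_state hbar gamma2 Op Oc Om rho -> no_dark_population Om rho ->
     rho (lvl1 N) (lvl2 N) =
       'i%C * ((rho0 gamma2 Op * \sum_(n < N) Om n ^+ 2)
               / (\sum_(n < N) Om n ^+ 2 + Gamma gamma2 Op Oc ^+ 2))%:C).
Proof.
move=> _ hbar0 g0 p0 c0 _; split.
  pose M := stationary_mx gamma2 Op Oc Om.
  exists ((\tr M)^-1 *: M); split; last first.
    by apply: no_dark_populationZ; exact: stationary_mx_dark.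
  split.
    apply: density_matrix_normalize; first exact: stationary_mx_psd.
    exact: stationary_mx_trace_gt0.
  by apply/master_equation_cstP; rewrite lindblad_rhsZ stationary_mx_lindblad ?gt_eqF ?scaler0.
move=> rho [dm /master_equation_cstP rhs0] dark.
rewrite (steady_coherence hbar0 g0 p0 c0 dm rhs0 dark) /rho0 /Gamma.
set S := \sum_(n < N) _; have S0 : 0 <= S by apply: sumr_ge0 => n _; exact: sqr_ge0.
have d0 : 0 < gamma2 ^+ 2 + 2 * Op ^+ 2 by rewrite addr_gt0 ?mulr_gt0 ?exprn_gt0.
have e0 : 0 <= 2 * Op ^+ 2 * (Oc ^+ 2 + Op ^+ 2).
  by rewrite mulr_ge0 ?addr_ge0 ?sqr_ge0 // mulr_ge0 ?sqr_ge0.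
(* The radicand of [Gamma] is nonnegative, so its square is [e / d]; clearing [d], also the
   denominator of [rho0], gives the formula. *)
rewrite (sqr_sqrtr (divr_ge0 e0 (ltW d0))); congr (_ * _%:C).
have := denominator_gt0 gamma2 Oc p0 S0; move: d0 e0.
set d := _ + 2 * _; set e := 2 * _ * _ => d0 e0 de0.
by field; rewrite !gt_eqF.
Qed.
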